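(* Fix a family $\mathcal Q=\{\mathcal Q_t(s,a): t=-1,\dots,T-1,\ s\in\mathcal S_t,\ a\in\mathcal A_t\}$ of feasible transition sets. Define $W_T(s)=y(s)$ for $s\in\mathcal S_T$ and, for $t=T-1,\dots,-1$ and $s\in\mathcal S_t$, $$W_t(s)=\max_{a\in\mathcal A_t}\ \min_{q\in\mathcal Q_t(s,a)}\ \sum_{s'\in\mathcal S_{t+1}(s,a)}q(s')\,W_{t+1}(s').$$ Then, for $t\ge 0$ and $s\in\mathcal S_t$, $$W_t(s)=\max_{d_{t:T-1}}\underline V_t^d(s;\mathcal Q),\qquad d_{t:T-1}=(d_t,\dots,d_{T-1}),$$ and any selectors $$d_t^*(s)\in\operatorname*{arg\,max}_{a\in\mathcal A}\ \min_{q\in\mathcal Q_t(s,a)}\ \sum_{s'\in\mathcal S_{t+1}(s,a)}q(s')\,W_{t+1}(s'),\qquad t=0,\dots,T-1,\ s\in\mathcal S_t,$$ form a maximin-optimal regime $d^*$. In particular, $$W_{-1}( * )=\max_{d\in\mathcal D}\underline\theta^d=\underline\theta^{d^*}.$$ Under the default root set $\mathcal Q_{-1}( *,\star)=\{P(S_0\in\cdot)\}$, $W_{-1}( * )=\sum_{s_0\in\mathcal S_0}P(s_0)\,W_0(s_0)$.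
   Context: **Spaces.** Fix $T\ge 1$, finite state spaces $\mathcal S_0,\dots,\mathcal S_T$, a finite treatment space $\mathcal A$, a finite outcome space $\mathcal Y\subseteq\mathbb R$ and a known map $y:\mathcal S_T\to\mathcal Y$; $Y=y(S_T)$. A regime is $d=(d_0,\dots,d_{T-1})$ with $d_t:\mathcal S_t\to\mathcal A$; $\mathcal D$ is the set of all regimes. $\Delta(X)$ is the set of probability distributions on a finite set $X$; distributions on a subset are extended by zero. **Model and true kernels.** A structural causal model (SCM) $M$ has mutually independent exogenous variables $\varepsilon_0^S$, $\varepsilon_t^U,\varepsilon_t^A,\varepsilon_{t+1}^S$ ($0\le t\le T-1$) and equations $S_0=f_0^S(\varepsilon_0^S)$, $U_t=f_t^U(\varepsilon_t^U)$, $A_t=f_t^A(S_t,U_t,\varepsilon_t^A)$, $S_{t+1}=f_{t+1}^S(S_t,A_t,U_t,\varepsilon_{t+1}^S)$, with $S_t\in\mathcal S_t$, $A_t\in\mathcal A$. Its structural transition kernel is $\kappa_{M,t}(\cdot\mid s,a)=$ law of $f_{t+1}^S(s,a,U_t,\varepsilon_{t+1}^S)$ for fixed $(s,a)$. A family $\mathbf S$ of nonempty sets $\mathcal S_{t+1}(s,a)\subseteq\mathcal S_{t+1}$ ($0\le t\le T-1$, $s\in\mathcal S_t$, $a\in\mathcal A$) is fixed, and $f_{t+1}^S(s,a,\cdot,\cdot)$ takes values in $\mathcal S_{t+1}(s,a)$. A graph $G$ specifies at which steps $t$ a bidirected edge $A_t\leftrightarrow S_{t+1}$ is present; where it is absent,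 $U_t$ may not enter both the $A_t$- and $S_{t+1}$-equations. The data are generated by a fixed true SCM $M^\star$ satisfying all these requirements, with observational law $P$ (the law of $(S_0,A_0,\dots,A_{T-1},S_T)$). Write $\kappa_t=\kappa_{M^\star,t}$ for $t\ge 0$. **Root convention.** $\mathcal S_{-1}=\{*\}$, $\mathcal A_{-1}=\{\star\}$, $d_{-1}( * )=\star$, $\mathcal S_0( *,\star)=\mathcal S_0$, $\kappa_{-1}(\cdot\mid *,\star)=P(S_0\in\cdot)$; $\mathcal A_t=\mathcal A$ for $t\ge 0$. **Family of feasible transition sets.** Each $\mathcal Q_t(s,a)\subseteq\Delta(\mathcal S_{t+1}(s,a))$ is nonempty, compact, convex and satisfies $\kappa_t(\cdot\mid s,a)\in\mathcal Q_t(s,a)$. **Ambiguity set and lower bound.** $\mathcal P^d(\mathcal Q)$ is the set of distributions $Q$ on trajectories $\mathbf v=(s_0,a_0,\dots,a_{T-1},s_T)$ of the form $$Q(\mathbf v)=q_{-1}(s_0\mid *,\star)\prod_{t=0}^{T-1}\mathbf 1\{a_t=d_t(s_t)\}\,q_t(s_{t+1}\mid s_t,a_t),$$ with $q_t(\cdot\mid s,d_t(s))\in\mathcal Q_t(s,d_t(s))$ for all $t=-1,\dots,T-1$, $s\in\mathcal S_t$. Put $\underline\theta^d=\inf_{Q\in\mathcal P^d(\mathcal Q)}\mathbb E^Q[Y]$. A regime $d$ is *maximin optimal* if it maximizes $\underline\theta^{d}$ over $\mathcal D$. **Lower value functions.** For $t\in\{-1,\dots,T-1\}$ and $s\in\mathcal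 S_t$, $\mathcal P_t^d(s;\mathcal Q)$ is the set of laws of $(S_{t+1},\dots,S_T)$ of the form $\prod_{k=t}^{T-1}q_k(s_{k+1}\mid s_k,d_k(s_k))$ with $s_t:=s$ and $q_k(\cdot\mid x,d_k(x))\in\mathcal Q_k(x,d_k(x))$ for all $k=t,\dots,T-1$, $x\in\mathcal S_k$; $\mathcal P_T^d(s;\mathcal Q)=\{\delta_s\}$. $\underline V_t^d(s;\mathcal Q)=\inf_{Q\in\mathcal P_t^d(s;\mathcal Q)}\mathbb E^Q[Y]$; for $t\geq 0$ it depends on $d$ only through $d_{t:T-1}$ (for $t=T$ this tuple is empty). *)

(* Defs.v *)
From HB Require Import structures.
From mathcomp Require Import all_boot all_order all_algebra.
From mathcomp Require Import all_classical all_reals all_analysis.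

Set Implicit Arguments.
Unset Strict Implicit.
Unset Printing Implicit Defensive.

Import Order.TTheory GRing.Theory Num.Theory.
Import numFieldNormedType.Exports.

Local Open Scope classical_set_scope.
Local Open Scope ring_scope.

Definition succ_ord (m : nat) (i : 'I_m) : 'I_m.+1 :=
  @Ordinal m.+1 i.+1 (ltn_ord i).

Definition widen1 (m : nat) (i : 'I_m) : 'I_m.+1 := widen_ord (leqnSn m) i.

Definition is_max (R : realType) (E : set R) (x : R) : Prop := E x /\ ubound E x.

Definition is_min (R : realType) (E : set R) (x : R) : Prop := E x /\ lbound E x.

(* Distributions on the subset B of X, extended by zero to X. *)
Definition simplex (R : realType) (X : finType) (B : {set X}) : set (X -> R) :=
  [set q | [/\ forall x, 0 <= q x, forall x, x \notin B -> q x = 0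
             & \sum_x q x = 1]].

(* Shifted time: stage n stands for t = n - 1, so that stage 0 is the root
   t = -1.  Note that [stage_state S n.+1] is convertible to [S n]. *)
Definition stage_state (S : nat -> finType) (n : nat) : finType :=
  if n is t.+1 then S t else unit.

Definition stage_act (A : finType) (n : nat) : finType :=
  if n is _.+1 then A else unit.

(* Indices of the exogenous variables eps^S_t (0 <= t <= T), eps^U_t and
   eps^A_t (0 <= t < T). *)
Definition exo (T : nat) : finType := ('I_T.+1 + ('I_T + 'I_T))%type.
Definition exoS (T : nat) (t : 'I_T.+1) : exo T := inl t.
Definition exoU (T : nat) (t : 'I_T) : exo T := inr (inl t).
Definition exoA (T : nat) (t : 'I_T) : exo T := inr (inr t).

(* The state and treatment spaces are discrete, so measurability of an
   equation valued in one of them is measurability of its fibres. *)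
Record scm (R : realType) (T : nat) (S : nat -> finType) (A : finType) := SCM {
  scm_disp : measure_display ;
  scm_Omega : measurableType scm_disp ;
  scm_Pr : probability scm_Omega R ;
  exo_disp : exo T -> measure_display ;
  exo_space : forall i : exo T, measurableType (exo_disp i) ;
  eps : forall i : exo T, scm_Omega -> exo_space i ;
  eps_measurable : forall i, measurable_fun setT (eps i) ;
  (* product rule over the whole finite family; subfamilies are recovered by
     taking the other events to be setT *)
  eps_independent : forall B : forall i : exo T, set (exo_space i),
    (forall i, measurable (B i)) ->
    scm_Pr (\bigcap_(i in [set: exo T]) (eps i @^-1` B i)) =
    (\prod_(i : exo T) fine (scm_Pr (eps i @^-1` B i)))%:E ;
  U_disp : 'I_T -> measure_display ;
  U_space : forall t : 'I_T, measurableType (U_disp t) ;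
  fS0 : exo_space (exoS ord0) -> S 0%N ;
  fU : forall t : 'I_T, exo_space (exoU t) -> U_space t ;
  fA : forall t : 'I_T, S t -> U_space t -> exo_space (exoA t) -> A ;
  fS : forall t : 'I_T,
    S t -> A -> U_space t -> exo_space (exoS (succ_ord t)) -> S t.+1 ;
  fS0_measurable : forall s, measurable [set e | fS0 e = s] ;
  fU_measurable : forall t, measurable_fun setT (@fU t) ;
  fA_measurable : forall t s a,
    measurable [set z : (U_space t * exo_space (exoA t))%type
               | fA s z.1 z.2 = a] ;
  fS_measurable : forall t s a s',
    measurable [set z : (U_space t * exo_space (exoS (succ_ord t)))%type
               | fS s a z.1 z.2 = s'] }.

(* (s_0, ..., s_T) together with (a_0, ..., a_{T-1}). *)
Definition trajectory (T : nat) (S : nat -> finType) (A : finType) : finType :=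
  ({dffun forall k : 'I_T.+1, S k} * {ffun 'I_T -> A})%type.

Section Model.
Variables (R : realType) (T : nat) (S : nat -> finType) (A : finType).
Variable M : scm R T S A.

Definition scm_U (t : 'I_T) (w : scm_Omega M) : U_space M t :=
  fU (eps (exoU t) w).

Fixpoint scm_S (t : nat) : (t < T.+1)%N -> scm_Omega M -> S t :=
  match t with
  | 0 => fun _ w => fS0 (eps (exoS ord0) w)
  | t'.+1 => fun H w =>
      let i : 'I_T := @Ordinal T t' H in
      let s : S t' := scm_S (ltnW H) w in
      let a : A := @fA _ _ _ _ M i s (scm_U i w) (eps (exoA i) w) in
      @fS _ _ _ _ M i s a (scm_U i w) (eps (exoS (succ_ord i)) w)
  end.

Definition scm_A (t : 'I_T) (w : scm_Omega M) : A :=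
  fA (scm_S (ltn_ord (widen1 t)) w) (scm_U t w) (eps (exoA t) w).

Definition scm_trajectory (w : scm_Omega M) : trajectory T S A :=
  ([ffun k : 'I_T.+1 => scm_S (ltn_ord k) w], [ffun t => scm_A t w]).

Definition obs_law (E : set (trajectory T S A)) : \bar R :=
  scm_Pr M (scm_trajectory @^-1` E).

Definition initial_law (s : S 0%N) : R :=
  fine (obs_law [set v : trajectory T S A | v.1 ord0 = s]).

Definition structural_kernel (t : 'I_T) (s : S t) (a : A) (s' : S t.+1) : R :=
  fine (scm_Pr M
    [set w | fS s a (scm_U t w) (eps (exoS (succ_ord t)) w) = s']).

Definition stage_kernel (n : 'I_T.+1) :
    stage_state S n -> stage_act A n -> S n -> R :=
  let: Ordinal n' H := n in
  match n' return (n' < T.+1)%N ->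
      stage_state S n' -> stage_act A n' -> S n' -> R with
  | 0 => fun _ _ _ => initial_law
  | t.+1 => fun H s a => @structural_kernel (@Ordinal T t H) s a
  end H.

End Model.

Section DecisionProblem.
Variables (R : realType) (T : nat) (S : nat -> finType) (A : finType).

(* supp t s a is the set S_{t+1}(s,a). *)
Variable supp : forall t : 'I_T, S t -> A -> {set S t.+1}.

Definition stage_supp (n : 'I_T.+1) :
    stage_state S n -> stage_act A n -> {set S n} :=
  let: Ordinal n' H := n in
  match n' return (n' < T.+1)%N ->
      stage_state S n' -> stage_act A n' -> {set S n'} with
  | 0 => fun _ _ _ => [set: S 0%N]%SET
  | t.+1 => fun H s a => @supp (@Ordinal T t H) s a
  end H.

(* G t holds iff the bidirected edge A_t <-> S_{t+1} is present; when it is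
   absent, u is a dummy argument of one of the two equations. *)
Definition scm_compatible (G : pred 'I_T) (M : scm R T S A) : Prop :=
  (forall (t : 'I_T) (s : S t) (a : A) u e, @fS _ _ _ _ M t s a u e \in supp s a)
  /\
  (forall t : 'I_T, ~~ G t ->
     (forall s u u' e, @fA _ _ _ _ M t s u e = @fA _ _ _ _ M t s u' e) \/
     (forall s a u u' e, @fS _ _ _ _ M t s a u e = @fS _ _ _ _ M t s a u' e)).

Variable Q : forall n : 'I_T.+1,
  stage_state S n -> stage_act A n -> set (S n -> R).

(* As S_{t+1} is finite, pointwise convergence is the usual topology on
   functions S_{t+1} -> R. *)
Definition feasible_family (M : scm R T S A) : Prop :=
  forall (n : 'I_T.+1) (s : stage_state S n) (a : stage_act A n),
    [/\ Q s a `<=` simplex (R := R) (stage_supp s a),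
        Q s a !=set0,
        @compact {ptws S n -> R} (Q s a),
        @convex_set R (S n -> R^o) (Q s a)
      & Q s a (stage_kernel M s a)].

Definition regime : Type := forall t : 'I_T, S t -> A.

Definition stage_regime (d : regime) (n : 'I_T.+1) :
    stage_state S n -> stage_act A n :=
  let: Ordinal n' H := n in
  match n' return (n' < T.+1)%N -> stage_state S n' -> stage_act A n' with
  | 0 => fun _ _ => tt
  | t.+1 => fun H s => d (@Ordinal T t H) s
  end H.

Definition kernel_family : Type :=
  forall n : 'I_T.+1, stage_state S n -> stage_act A n -> S n -> R.

Variable y : S T -> R.

Definition trajectory_law (d : regime) (q : kernel_family)
    (v : trajectory T S A) : R :=
  q ord0 tt tt (v.1 ord0) *
  \prod_(t < T) ((v.2 t == d t (v.1 (widen1 t)))%:R *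
                 q (succ_ord t) (v.1 (widen1 t)) (v.2 t) (v.1 (succ_ord t))).

Definition ambiguity_set (d : regime) : set (trajectory T S A -> R) :=
  [set P | exists q : kernel_family,
     (forall (n : 'I_T.+1) (s : stage_state S n),
        Q s (stage_regime d s) (q n s (stage_regime d s))) /\
     P = trajectory_law d q].

Definition theta_lower (d : regime) : R :=
  inf [set \sum_(v : trajectory T S A) P v * y (v.1 ord_max)
      | P in ambiguity_set d].

Definition maximin_optimal (d : regime) : Prop :=
  forall d' : regime, theta_lower d' <= theta_lower d.

(* Paths from stage n to the horizon.  The initial coordinate, which the law
   below pins to the starting state s, is kept; at the horizon this law is
   then the Dirac mass at s. *)
Definition tail_path (n : 'I_T.+2) : finType :=
  {dffun forall k : {k : 'I_T.+2 | (n <= k)%N}, stage_state S (val k)}.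

Definition tail_first (n : 'I_T.+2) : {k : 'I_T.+2 | (n <= k)%N} :=
  exist _ n (leqnn n).

Definition tail_last (n : 'I_T.+2) : {k : 'I_T.+2 | (n <= k)%N} :=
  exist (fun k : 'I_T.+2 => (n <= k)%N) ord_max (ltn_ord n).

Definition tail_from (n : 'I_T.+2) (k : {k : 'I_T.+1 | (n <= k)%N}) :
    {k : 'I_T.+2 | (n <= k)%N} :=
  exist (fun k : 'I_T.+2 => (n <= k)%N) (widen1 (val k)) (valP k).

Definition tail_to (n : 'I_T.+2) (k : {k : 'I_T.+1 | (n <= k)%N}) :
    {k : 'I_T.+2 | (n <= k)%N} :=
  exist (fun k : 'I_T.+2 => (n <= k)%N) (succ_ord (val k)) (leqW (valP k)).

Definition tail_law (d : regime) (q : kernel_family) (n : 'I_T.+2)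
    (s : stage_state S n) (x : tail_path n) : R :=
  ((x (tail_first n) : stage_state S n) == s)%:R *
  \prod_(k : {k : 'I_T.+1 | (n <= k)%N})
     q (val k) (x (tail_from k))
       (@stage_regime d (val k) (x (tail_from k))) (x (tail_to k)).

Definition tail_ambiguity_set (d : regime) (n : 'I_T.+2)
    (s : stage_state S n) : set (tail_path n -> R) :=
  [set P | exists q : kernel_family,
     (forall (k : 'I_T.+1) (x : stage_state S k), (n <= k)%N ->
        Q x (stage_regime d x) (q k x (stage_regime d x))) /\
     P = tail_law d q s].

Definition V_lower (d : regime) (n : 'I_T.+2) (s : stage_state S n) : R :=
  inf [set \sum_(x : tail_path n) P x * y (x (tail_last n))
      | P in tail_ambiguity_set d s].

Definition expected_values (n : 'I_T.+1) (s : stage_state S n)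
    (a : stage_act A n) (w : S n -> R) : set R :=
  [set \sum_(s' in stage_supp s a) q s' * w s' | q in Q s a].

Definition worst_value (n : 'I_T.+1) (s : stage_state S n)
    (a : stage_act A n) (w : S n -> R) : R :=
  inf (expected_values s a w).

(* Backward induction from the horizon, m stages before it; see [W_last] and
   [W_step] for the recursion. *)
Fixpoint W_before (m : nat) :
    forall n : nat, (m + n)%N = T.+1 -> stage_state S n -> R :=
  match m with
  | 0 => fun n e s => y (ecast i (stage_state S i) e s)
  | m'.+1 => fun n e s =>
      let i : 'I_T.+1 := @Ordinal T.+1 n (leq_trans (leq_addl m' n.+1)
        (eq_leq (etrans (addnS m' n) e))) in
      sup [set @worst_value i s a
                 (@W_before m' n.+1 (etrans (addnS m' n) e))
          | a in [set: stage_act A i]]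
  end.

Definition W (n : 'I_T.+2) (s : stage_state S n) : R :=
  W_before (subnK (ltn_ord n : (n <= T.+1)%N)) s.

Lemma W_beforeE (m m' n : nat) (e : (m + n)%N = T.+1)
    (e' : (m' + n)%N = T.+1) (s : stage_state S n) :
  W_before e s = W_before e' s.
Proof.
have mm : m = m' by apply/eqP; rewrite -(eqn_add2r n) e e'.
by subst m'; rewrite (eq_irrelevance e e').
Qed.

Lemma W_last (s : S T) : W (n := ord_max) s = y s.
Proof.
have e0 : (0 + T.+1)%N = T.+1 by [].
rewrite /W (@W_beforeE _ 0 T.+1 _ e0).
by rewrite (eq_irrelevance e0 (erefl T.+1)).
Qed.

Lemma W_step (n : 'I_T.+1) (s : stage_state S n) :
  W (n := widen1 n) s =
  sup [set worst_value s a (W (n := succ_ord n)) | a in [set: stage_act A n]].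
Proof.
case: n s => n Hn s; have e : ((T - n).+1 + n)%N = T.+1.
  by rewrite addSn subnK// -ltnS.
rewrite /W (@W_beforeE _ (T - n).+1 _ _ e) /=.
congr sup; congr image; apply/funext => a.
rewrite (bool_irrelevance (leq_trans _ _) Hn).
by congr worst_value; apply/funext => s'; exact: W_beforeE.
Qed.

Definition maximin_selector (d : regime) : Prop :=
  forall (t : 'I_T) (s : S t) (a : A),
    @worst_value (succ_ord t) s a (W (n := succ_ord (succ_ord t))) <=
    @worst_value (succ_ord t) s (d t s) (W (n := succ_ord (succ_ord t))).

End DecisionProblem.

(* Main.v *)
(* W is subharmonic along the kernels of any law of a selector regime, and -W is
   subharmonic along the kernels that attain every worst value, whatever the
   regime.  A function subharmonic along nonnegative kernels is at most the
   weighted sum over paths of its terminal value, so W bounds the lower values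
   of every regime from above and those of a selector from below.  The worst
   values are attained by compactness of the transition sets. *)
Require Import Defs.
From HB Require Import structures.
From mathcomp Require Import all_boot all_order all_algebra.
From mathcomp Require Import all_classical all_reals all_analysis.

Import Order.TTheory GRing.Theory Num.Theory.
Import numFieldNormedType.Exports.

Local Open Scope classical_set_scope.
Local Open Scope ring_scope.

(** * Subharmonic functions along a finite chain of coordinates *)

Section Chain.
(** Coordinates [I] and transitions [K] stay abstract so that one inequality covers both tail paths,
    indexed by a subtype of stages, and trajectories, indexed by times; [h] is the clock. *)
Context {R : realType} {I K : finType} (X : I -> finType).
Variables (src dst : K -> I) (h : I -> nat) (last : I).
Hypothesis h_inj : injective h.
Hypothesis src_inj : injective src.
Hypothesis h_dst : forall k, h (dst k) = (h (src k)).+1.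
Hypothesis h_last : forall i, (h i <= h last)%N.
Hypothesis src_onto : forall i, i != last -> exists k, src k = i.

Definition agree_upto (j : I) (x0 x : {dffun forall i, X i}) : bool :=
  [forall i, (h i <= h j)%N ==> (x i == x0 i)].

(** By injectivity of [h], [dst k] is the only coordinate one tick after [src k], so prescribing it
    amounts to overwriting [x0] there; earlier coordinates are untouched. *)
Lemma agree_upto_step k (x0 x : {dffun forall i, X i}) (t : X (dst k)) :
  agree_upto (src k) x0 x && (x (dst k) == t) =
  agree_upto (dst k) (finfun (eqtype.dfwith x0 t)) x.
Proof.
apply/andP/forallP => [[/forallP xx0 /eqP xt] i|xx0].
  apply/implyP; rewrite h_dst leq_eqVlt => /orP[/eqP|] hi.
    have <- : dst k = i by apply: h_inj; rewrite h_dst.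
    by rewrite ffunE dfwith_in xt.
  rewrite ffunE dfwith_out; first by have /implyP := xx0 i; exact.
  by apply: contraTneq hi => <-; rewrite h_dst ltnn.
split.
  apply/forallP => i; apply/implyP => hi.
  have /implyP := xx0 i; rewrite h_dst => /(_ (leqW hi)).
  rewrite ffunE dfwith_out//.
  by apply: contraTneq hi => <-; rewrite h_dst ltnn.
by have /implyP/(_ (leqnn _)) := xx0 (dst k); rewrite ffunE dfwith_in.
Qed.

Variables (p : forall k, X (src k) -> X (dst k) -> R) (w : forall i, X i -> R)
  (f : X last -> R).
Hypothesis p_ge0 : forall k s t, 0 <= p k s t.
Hypothesis w_le : forall k s, w (src k) s <= \sum_t p k s t * w (dst k) t.
Hypothesis w_last : forall s, w last s <= f s.

(* Backward induction on j, summing over the next coordinate; since paths are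
   pinned to x0 up to j, all partial sums range over one and the same type. *)
Lemma chain_le j (x0 : {dffun forall i, X i}) :
  w j (x0 j) <= \sum_(x | agree_upto j x0 x)
    (\prod_(k | (h j <= h (src k))%N) p k (x (src k)) (x (dst k))) *
    f (x last).
Proof.
have [n] := ubnP (h last - h j); elim: n => // n IHn in j x0 *.
rewrite ltnS => hn.
have [->|] := eqVneq j last.
  (* At [last] the only pinned path is [x0], and the product is empty because no [dst k] lies beyond
     [last]. *)
  rewrite (big_pred1 x0) => [|x].
    rewrite big_pred0 ?mul1r// => k.
    by apply/negbTE; rewrite -ltnNge -h_dst h_last.
  apply/forallP/eqP => [xx0|-> i]; last by rewrite eqxx implybT.
  by apply/ffunP => i; have /implyP/(_ (h_last i))/eqP := xx0 i.
move=> /src_onto[k jE]; subst j.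
apply: le_trans (w_le _ _) _.
(* Split the paths by their value [t] at the next coordinate; pinning that value too gives a sum to
   which the induction hypothesis applies. *)
rewrite (partition_big (fun x : {dffun forall i, X i} => x (dst k)) predT)//=.
apply: ler_sum => t _.
under eq_bigl do rewrite agree_upto_step.
set x1 := finfun _.
have x1t : x1 (dst k) = t by rewrite ffunE dfwith_in.
have x1s : x1 (src k) = x0 (src k).
  rewrite ffunE dfwith_out//; apply/eqP => ds.
  by have /eqP := h_dst k; rewrite ds ltn_eqF.
have hk : (h last - h (dst k) < n)%N.
  rewrite h_dst; have := h_last (dst k); rewrite h_dst => hl.
  by rewrite (leq_trans _ hn)// subnS prednK// subn_gt0.
have := IHn (dst k) x1 hk; rewrite {1}x1t => /(ler_wpM2l (p_ge0 k (x0 (src k)) t)).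
move=> /le_trans; apply; rewrite mulr_sumr le_eqVlt; apply/orP; left.
apply/eqP/eq_bigr => x /forallP xx1; rewrite mulrA; congr (_ * _).
(* Take out the factor of [k]: by injectivity of [h] and [src], the other transitions starting no
   earlier than [src k] are exactly those starting no earlier than [dst k]. *)
rewrite [RHS](bigD1 k)//=.
have /implyP/(_ (leqnn _))/eqP -> := xx1 (dst k); rewrite x1t.
have /implyP := xx1 (src k); rewrite h_dst => /(_ (leqnSn _))/eqP ->; rewrite x1s.
congr (_ * _); apply: eq_bigl => k'; rewrite ltn_neqAle andbC; congr (_ && _).
by rewrite (inj_eq h_inj) (inj_eq src_inj) eq_sym.
Qed.

End Chain.

(** * Path bounds for tail laws and trajectory laws *)

Section Laws.
Context {R : realType} {T : nat} {S : nat -> finType} {A : finType}.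
Implicit Types (d : regime T S A) (q : kernel_family R T S A).

(* Needed because the ordinals [widen1 (succ_ord t)] and [succ_ord (widen1 t)]
   are not convertible. *)
Lemma stage_fun_irr (w : forall n : 'I_T.+2, stage_state S n -> R) (n : nat)
    (H H' : (n < T.+2)%N) (s : stage_state S n) :
  w (Ordinal H) s = w (Ordinal H') s.
Proof. by rewrite (bool_irrelevance H H'). Qed.

Lemma stage_regimeS d (t : 'I_T) (s : S t) :
  stage_regime d (n := succ_ord t) s = d t s.
Proof.
case: t s => t H s.
by rewrite /stage_regime /succ_ord (bool_irrelevance (ltn_ord (Ordinal H)) H).
Qed.

Definition nonneg_from n d q : Prop := forall (k : 'I_T.+1) (s : stage_state S k) t,
  (n <= k)%N -> 0 <= q k s (stage_regime d s) t.

Definition subharmonic_from n d q (w : forall n : 'I_T.+2, stage_state S n -> R) :=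
  forall (k : 'I_T.+1) (s : stage_state S k), (n <= k)%N ->
    w (widen1 k) s <= \sum_t q k s (stage_regime d s) t * w (succ_ord k) t.

Hypothesis inhS : forall n, (n <= T)%N -> S n.

Let inh_stage n : (n < T.+2)%N -> stage_state S n.
Proof. by case: n => [|n] Hn; [exact: tt|exact: inhS]. Qed.

Lemma tail_law_le d q w (y : S T -> R) (n : 'I_T.+2) (s : stage_state S n) :
  nonneg_from n d q -> subharmonic_from n d q w ->
  (forall s, w ord_max s <= y s) ->
  w n s <= \sum_(x : tail_path S n)
             tail_law d q s x * y (x (tail_last n)).
Proof.
move=> q0 wq wy.
pose X (k : {k : 'I_T.+2 | (n <= k)%N}) := stage_state S (val k).
(* Any path through [s] serves as base, since the pin at [tail_first n] constrains that coordinate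
   alone; the other entries are arbitrary. *)
pose x0 : {dffun forall k, X k} :=
  finfun (eqtype.dfwith (fun k => inh_stage _ (ltn_ord (val k))) (s : X (tail_first n))).
have x0n : x0 (tail_first n) = s by rewrite ffunE dfwith_in.
pose p k (s : X (tail_from k)) (t : X (tail_to k)) : R :=
  q (val k) s (stage_regime d (n := val k) s) t.
have := @chain_le R {k : 'I_T.+2 | (n <= k)%N} {k : 'I_T.+1 | (n <= k)%N} X
  (@tail_from _ n) (@tail_to _ n) (fun k => val (val k)) (tail_last n).
move=> /(_ _ _ _ _ _ p (fun k s => w (val k) s) y) H.
have := H _ _ _ _ _ _ _ _ (tail_first n) x0.
rewrite x0n => {}H.
apply: le_trans (H _ _ _ _ _ _ _ _) _ => {H}.
- by move=> i j ij; do 2!apply: val_inj.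
- by move=> i j /(congr1 (fun x => val (val x)))/= ij; do 2!apply: val_inj.
- by [].
- by move=> i; rewrite -ltnS; exact: ltn_ord.
- move=> [i ni] /eqP il.
  have iT : (i < T.+1)%N.
    rewrite ltn_neqAle -ltnS ltn_ord andbT; apply: contra_notN il => /eqP il.
    by do 2!apply: val_inj.
  by exists (exist (fun k : 'I_T.+1 => (n <= k)%N) (Ordinal iT) ni);
    do 2!apply: val_inj.
- by move=> k *; apply: q0; exact: (valP k).
- by move=> k s'; apply: wq; exact: (valP k).
- exact: wy.
(* What is left is an equality: the pin is the indicator in [tail_law], and every transition of the
   tail starts at stage [n] or later. *)
rewrite le_eqVlt; apply/orP; left; apply/eqP.
rewrite big_mkcond; apply: eq_bigr => x _; rewrite /tail_law.
have -> : agree_upto _ (fun k => val (val k)) (tail_first n) x0 x =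
          ((x (tail_first n) : stage_state S n) == s).
  apply/forallP/eqP => [/(_ (tail_first n))|xs i].
    by rewrite leqnn x0n => /eqP.
  apply/implyP => /= hi.
  have -> : i = tail_first n.
    by do 2!apply: val_inj => /=; apply/eqP; rewrite eqn_leq hi (valP i).
  by rewrite x0n; apply/eqP.
case: ifP => _; last by rewrite !mul0r.
rewrite mul1r; congr (_ * _); apply: eq_bigl => k /=; exact: (valP k).
Qed.

(** Trajectories carry actions but no root coordinate. The indicators collapse the sum over actions
    to those chosen by [d], the root kernel is treated by hand, and [chain_le] applies from the
    initial state on, with time [k] read as stage [k.+1]. *)
Lemma trajectory_law_le d q w (y : S T -> R) :
  nonneg_from 0 d q -> subharmonic_from 0 d q w ->
  (forall s, w ord_max s <= y s) ->
  w ord0 tt <= \sum_(v : trajectory T S A)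
             trajectory_law d q v * y (v.1 ord_max).
Proof.
move=> q0 wq wy.
pose F (x : {dffun forall k : 'I_T.+1, S k}) :=
  (\prod_(k < T)
     q (succ_ord k) (x (widen1 k)) (d k (x (widen1 k))) (x (succ_ord k))) *
  y (x ord_max).
have -> : \sum_(v : trajectory T S A) trajectory_law d q v * y (v.1 ord_max) =
    \sum_(x : {dffun forall k : 'I_T.+1, S k}) q ord0 tt tt (x ord0) * F x.
  rewrite -(pair_bigA _ (fun x a => trajectory_law d q (x, a) * y (x ord_max)))/=.
  apply: eq_bigr => x _.
  rewrite (bigD1 [ffun t => d t (x (widen1 t))])//= [X in _ + X]big1 ?addr0.
    rewrite /trajectory_law/= -mulrA; congr (_ * (_ * _)).
    by apply: eq_bigr => k _; rewrite ffunE eqxx mul1r.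
  move=> a /eqP adx; rewrite /trajectory_law/=.
  suff [k ak] : exists k, a k != d k (x (widen1 k)).
    by rewrite (bigD1 k)//= (negbTE ak) !(mul0r, mulr0).
  apply/existsP; rewrite -negb_forall; apply: contra_notN adx => /forallP adx.
  by apply/ffunP => k; rewrite ffunE; apply/eqP.
rewrite (partition_big (fun x : {dffun forall k : 'I_T.+1, S k} => x ord0) predT)//=.
have w0 : w (widen1 ord0) tt = w ord0 tt by exact: (stage_fun_irr w 0%N).
rewrite -w0; apply: (le_trans (wq ord0 tt (leqnn _))); apply: ler_sum => s _.
under eq_bigr => x /eqP -> do [].
rewrite -mulr_sumr; apply: ler_wpM2l; first exact: (q0 ord0).
pose x0 : {dffun forall k : 'I_T.+1, S k} :=
  finfun (eqtype.dfwith (fun k : 'I_T.+1 => inhS _ (ltn_ord k)) (s : S (@ord0 T))).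
have x0s : x0 ord0 = s by rewrite ffunE dfwith_in.
have := @chain_le R 'I_T.+1 'I_T (fun k => S k)
  (@widen1 T) (@succ_ord T) (fun k => val k) ord_max.
move=> /(_ _ _ _ _ _ (fun k s t => q (succ_ord k) s (d k s) t)
   (fun k s => w (succ_ord k) s) y) H.
have := H _ _ _ _ _ _ _ _ ord0 x0.
rewrite x0s => {}H.
apply: le_trans (H _ _ _ _ _ _ _ _) _ => {H}.
- exact: val_inj.
- by move=> i j /(congr1 val)/= ij; apply: val_inj.
- by [].
- by move=> i; rewrite -ltnS; exact: ltn_ord.
- move=> i /eqP il.
  have iT : (i < T)%N.
    rewrite ltn_neqAle -ltnS ltn_ord andbT; apply: contra_notN il => /eqP il.
    exact: val_inj.
  by exists (Ordinal iT); apply: val_inj.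
- by move=> k s' t; rewrite -stage_regimeS; apply: q0.
- move=> k s'; rewrite -stage_regimeS.
  have := wq (succ_ord k) s' (leq0n _).
  apply: le_trans; rewrite le_eqVlt; apply/orP; left; apply/eqP.
  exact: (stage_fun_irr w k.+1).
- move=> s'; apply: le_trans (wy s').
  by rewrite le_eqVlt; apply/orP; left; apply/eqP; exact: (stage_fun_irr w T.+1).
rewrite le_eqVlt; apply/orP; left; apply/eqP.
apply: eq_big => [x|//].
apply/forallP/eqP => [/(_ ord0)|xs i]; first by rewrite leqnn x0s => /eqP.
apply/implyP => /= hi.
have -> : i = ord0 by apply: val_inj; apply/eqP; rewrite eqn_leq hi.
by rewrite x0s; apply/eqP.
Qed.

End Laws.

(** * Attained extrema, and a point of the sample space *)

Lemma is_min_inf (R : realType) (E : set R) (x : R) : is_min E x -> inf E = x.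
Proof.
move=> [Ex xE]; apply/eqP; rewrite eq_le ge_inf//=; last by exists x.
by apply: lb_le_inf => //; exists x.
Qed.

Lemma is_max_sup (R : realType) (E : set R) (x : R) : is_max E x -> sup E = x.
Proof.
move=> [Ex Ex']; apply/eqP; rewrite eq_le ub_le_sup//=; last by exists x.
by rewrite andbT; apply: ge_sup => //; exists x.
Qed.

Lemma sup_finType_is_max (R : realType) (X : finType) (x0 : X) (f : X -> R) :
  is_max [set f x | x in [set: X]] (sup [set f x | x in [set: X]]).
Proof.
have [i _ fi] := @arg_maxP _ _ X x0 xpredT f isT.
have mi : is_max [set f x | x in [set: X]] (f i).
  by split; [exists i|move=> _ [x _ <-]; exact: fi].
by rewrite (is_max_sup _ _ _ mi).
Qed.

(** A sample point, run through the structural equations, will show that the treatment space and all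
    state spaces up to the horizon are inhabited. An empty space has mass zero, not one. *)
Lemma scm_Omega_inhabited (R : realType) (T : nat) (S : nat -> finType)
    (A : finType) (M : scm R T S A) : inhabited (scm_Omega M).
Proof.
apply: contrapT => Mempty.
have := @probability_setT _ _ _ (scm_Pr M).
rewrite (_ : setT = set0) ?measure0; last first.
  by apply/seteqP; split => // w _; apply: Mempty.
by move=> /eqP; rewrite eqe eq_sym oner_eq0.
Qed.

(** * Backward induction and attainment of the lower values *)

Section BackwardInduction.
Context {R : realType} {T : nat} {S : nat -> finType} {A : finType}.
Variables (y : S T -> R) (supp : forall t : 'I_T, S t -> A -> {set S t.+1}).
Variable Q : forall n : 'I_T.+1,
  stage_state S n -> stage_act A n -> set (S n -> R).
Hypothesis Q_simplex : forall (n : 'I_T.+1) s a,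
  Q n s a `<=` simplex (R := R) (stage_supp supp s a).
Hypothesis Q_neq0 : forall (n : 'I_T.+1) s a, Q n s a !=set0.
Hypothesis Q_compact : forall (n : 'I_T.+1) s a, @compact {ptws S n -> R} (Q n s a).
Hypothesis inhS : forall n, (n <= T)%N -> S n.
Hypothesis inhA : A.

Local Notation W n := (W supp Q y (n := n)).

Lemma sum_stage_supp (n : 'I_T.+1) (s : stage_state S n) (a : stage_act A n)
    (q w : S n -> R) : Q n s a q ->
  \sum_(t in stage_supp supp s a) q t * w t = \sum_t q t * w t.
Proof.
move=> /Q_simplex[_ q0 _]; rewrite big_mkcond; apply: eq_bigr => t _.
by case: ifPn => // /q0 ->; rewrite mul0r.
Qed.

(** The expectation is a finite combination of evaluations, hence continuous for pointwise
    convergence, and attains its minimum on a nonempty compact set. *)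
Lemma worst_value_is_min (n : 'I_T.+1) (s : stage_state S n)
    (a : stage_act A n) (w : S n -> R) :
  is_min (expected_values supp Q s a w) (worst_value supp Q s a w).
Proof.
pose f (q : {ptws S n -> R}) := \sum_(t in stage_supp supp s a) q t * w t.
have cf : continuous f.
  apply: continuous_big => [|t _]; first exact: add_continuous.
  move=> q.
  apply: (@continuous_comp _ _ _ (fun q : {ptws S n -> R} => q t) (fun x : R => x * w t)).
    exact: (@proj_continuous _ (fun=> R) t).
  exact: mulrr_continuous.
have [|q Qq fq] := @compact_EVT_min {ptws S n -> R} R f (Q n s a)
  (Q_neq0 n s a) (Q_compact n s a) _.
  exact: continuous_subspaceT.
suff mq : is_min (expected_values supp Q s a w) (f q).
  by rewrite /worst_value (is_min_inf _ _ _ mq).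
split; first by exists q => //; exact: set_mem.
by move=> _ [q' Qq' <-]; apply: fq; exact: mem_set.
Qed.

Lemma W_is_max (n : 'I_T.+1) (s : stage_state S n) :
  is_max [set worst_value supp Q s a (W (succ_ord n)) | a in [set: stage_act A n]]
         (W (widen1 n) s).
Proof.
rewrite W_step; apply: sup_finType_is_max.
by case: n s => -[|n] H s.
Qed.

Lemma selector_exists : exists d, maximin_selector supp Q y d.
Proof.
(* Choice is made over dependent pairs of a time and a state, then curried into a regime. *)
have /choice[d Hd] : forall ts : {t : 'I_T & S t}, exists a : A, forall a' : A,
    @worst_value R T S A supp Q (succ_ord (tag ts)) (tagged ts) a'
      (W (succ_ord (succ_ord (tag ts)))) <=
    @worst_value R T S A supp Q (succ_ord (tag ts)) (tagged ts) a
      (W (succ_ord (succ_ord (tag ts)))).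
  move=> [t s]; have [[a _ aW] Wa] := W_is_max (succ_ord t) s.
  by exists a => a'; rewrite aW; apply: Wa; exists a'.
by exists (fun t s => d (Tagged (fun t : 'I_T => S t) s)) => t s a;
  exact: (Hd (Tagged (fun t : 'I_T => S t) s) a).
Qed.

(** At the root the only action is [tt]; at later stages the selected action is at least as good as
    a maximizing one. *)
Lemma selector_W d (n : 'I_T.+1) (s : stage_state S n) :
  maximin_selector supp Q y d ->
  W (widen1 n) s = worst_value supp Q s (stage_regime d s) (W (succ_ord n)).
Proof.
move=> dW; have [[a _ <-] Wa] := W_is_max n s.
apply/eqP; rewrite eq_le Wa; last by exists (stage_regime d s).
rewrite andbT {Wa}; case: n s a => -[|n] H s a; first by case: a.
have := dW (@Ordinal T n H) s a.
rewrite /stage_regime /succ_ord (bool_irrelevance (@ltn_ord T (@Ordinal T n H)) H).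
exact.
Qed.

Definition feasible_from n (d : regime T S A) (q : kernel_family R T S A) :=
  forall (k : 'I_T.+1) (x : stage_state S k), (n <= k)%N ->
    Q k x (stage_regime d x) (q k x (stage_regime d x)).

Lemma feasible_nonneg n d q : feasible_from n d q -> nonneg_from n d q.
Proof. by move=> Qq k s t nk; have [+ _ _] := Q_simplex _ _ _ _ (Qq k s nk); exact. Qed.

(** Kernels have total mass one. With [c] a lower bound of [y], this bounds the values of all
    feasible laws from below. *)
Lemma feasible_const n d q c :
  feasible_from n d q -> subharmonic_from n d q (fun _ _ => c).
Proof.
move=> Qq k s nk; have [_ _ q1] := Q_simplex _ _ _ _ (Qq k s nk).
by rewrite -mulr_suml q1 mul1r.
Qed.

Lemma selector_subharmonic n d q : maximin_selector supp Q y d ->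
  feasible_from n d q -> subharmonic_from n d q (fun n => W n).
Proof.
move=> dW Qq k s nk; rewrite (selector_W _ _ _ dW) -(sum_stage_supp _ _ _ _ _ (Qq k s nk)).
have [_] := worst_value_is_min k s (stage_regime d s) (W (succ_ord k)); apply.
by exists (q k s (stage_regime d s)) => //; exact: Qq.
Qed.

(** A minimizing kernel is chosen for each stage, state and action before any regime is fixed, so
    one family serves every [d]; the action of [d] has worst value at most [W]. *)
Lemma worst_kernel_exists : exists q : kernel_family R T S A,
  forall d, feasible_from 0 d q /\
    subharmonic_from 0 d q (fun n s => - W n s).
Proof.
have qW (n : 'I_T.+1) (s : stage_state S n) (a : stage_act A n) :
    exists q, Q n s a q /\
      \sum_t q t * W (succ_ord n) t = worst_value supp Q s a (W (succ_ord n)).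
  have [[q Qq <-] _] := worst_value_is_min n s a (W (succ_ord n)).
  by exists q; split => //; rewrite (sum_stage_supp _ _ _ _ _ Qq).
exists (fun n s a => projT1 (cid (qW n s a))) => d; split=> k s _.
  by case: cid => q [].
case: cid => q [_ qk] /=; under eq_bigr do rewrite mulrN.
rewrite sumrN lerN2 qk; have [_] := W_is_max k s; apply.
by exists (stage_regime d s).
Qed.

Lemma y_lbound : exists c, forall s, c <= y s.
Proof.
exists (- \sum_s `|y s|) => s; rewrite lerNl (bigD1 s)//=.
by rewrite -normrN ler_wpDr ?sumr_ge0// ler_norm.
Qed.

(** The point is boundedness below, as [inf] of an unbounded set is a default value; the constant
    [c] supplies the bound. *)
Lemma tail_value_le_V d (n : 'I_T.+2) (s : stage_state S n) q :
  feasible_from n d q ->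
  V_lower Q y d s <= \sum_(x : tail_path S n) tail_law d q s x * y (x (tail_last n)).
Proof.
move=> Qq; apply: ge_inf; last first.
  by exists (tail_law d q s) => //; exists q.
have [c cy] := y_lbound; exists c => _ [_ [q' [Qq' ->] <-]].
by apply: (tail_law_le inhS _ _ (fun _ _ => c)) => //;
  [exact: feasible_nonneg|exact: feasible_const].
Qed.

Lemma trajectory_value_le_theta d q : feasible_from 0 d q ->
  theta_lower Q y d <=
  \sum_(v : trajectory T S A) trajectory_law d q v * y (v.1 ord_max).
Proof.
move=> Qq; apply: ge_inf; last first.
  by exists (trajectory_law d q) => //; exists q; split => // n s; exact: Qq.
have [c cy] := y_lbound; exists c => _ [_ [q' [Qq' ->] <-]].
have {}Qq' : feasible_from 0 d q' by move=> *; exact: Qq'.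
by apply: (trajectory_law_le inhS _ _ (fun _ _ => c)) => //;
  [exact: feasible_nonneg|exact: feasible_const].
Qed.

Lemma V_lower_le_W d (n : 'I_T.+2) (s : stage_state S n) :
  V_lower Q y d s <= W n s.
Proof.
have [q /(_ d)[Qq qW]] := worst_kernel_exists.
apply: (@le_trans _ _ _ _ _ (tail_value_le_V d n s q _)) => [k x _|]; first exact: Qq.
(* Changing signs turns the upper bound into an instance of [tail_law_le], for [-W] with terminal
   value [-y]. *)
rewrite -lerN2 -sumrN; under eq_bigr do rewrite -mulrN.
apply: (tail_law_le inhS _ _ (fun n s => - W n s) (fun s => - y s)) => [||x].
- by apply: feasible_nonneg => k x _; exact: Qq.
- by move=> k x _; exact: qW.
- by rewrite W_last.
Qed.

Lemma theta_lower_le_W d : theta_lower Q y d <= W ord0 tt.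
Proof.
have [q /(_ d)[Qq qW]] := worst_kernel_exists.
apply: (le_trans (trajectory_value_le_theta d q Qq)).
rewrite -lerN2 -sumrN; under eq_bigr do rewrite -mulrN.
apply: (trajectory_law_le inhS _ _ (fun n s => - W n s) (fun s => - y s)) => [||x].
- exact: feasible_nonneg.
- exact: qW.
- by rewrite W_last.
Qed.

Lemma selector_V_lower d (n : 'I_T.+2) (s : stage_state S n) :
  maximin_selector supp Q y d -> V_lower Q y d s = W n s.
Proof.
move=> dW; apply/eqP; rewrite eq_le V_lower_le_W/=; apply: lb_le_inf.
  (* [lb_le_inf] asks for a nonempty set; the worst kernels give a member. *)
  have [q /(_ d)[Qq _]] := worst_kernel_exists.
  exists (\sum_x tail_law d q s x * y (x (tail_last n))); exists (tail_law d q s) => //.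
  by exists q; split => // k x _; exact: Qq.
move=> _ [_ [q [Qq ->] <-]]; apply: (tail_law_le inhS _ _ (fun n => W n)) => [||x].
- exact: feasible_nonneg.
- exact: selector_subharmonic.
- by rewrite W_last.
Qed.

Lemma selector_theta_lower d :
  maximin_selector supp Q y d -> theta_lower Q y d = W ord0 tt.
Proof.
move=> dW; apply/eqP; rewrite eq_le theta_lower_le_W/=; apply: lb_le_inf.
  have [q /(_ d)[Qq _]] := worst_kernel_exists.
  exists (\sum_v trajectory_law d q v * y (v.1 ord_max)); exists (trajectory_law d q) => //.
  by exists q; split => // k x; exact: Qq.
move=> _ [_ [q [Qq ->] <-]].
have {}Qq : feasible_from 0 d q by move=> *; exact: Qq.
apply: (trajectory_law_le inhS _ _ (fun n => W n)) => [||x].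
- exact: feasible_nonneg.
- exact: selector_subharmonic.
- by rewrite W_last.
Qed.

End BackwardInduction.

Theorem theorem4p9 (R : realType) (T : nat) (hT : (1 <= T)%N)
    (S : nat -> finType) (A : finType)
    (Y : set R) (finY : finite_set Y)
    (y : S T -> R) (yY : forall s, Y (y s))
    (supp : forall t : 'I_T, S t -> A -> {set S t.+1})
    (supp_neq0 : forall (t : 'I_T) (s : S t) (a : A), supp t s a != finset.set0)
    (G : pred 'I_T)
    (M : scm R T S A) (hM : scm_compatible supp G M)
    (Q : forall n : 'I_T.+1,
       stage_state S n -> stage_act A n -> set (S n -> R))
    (hQ : feasible_family supp Q M) :
  (* the minima and maxima defining W are attained *)
  ((forall (n : 'I_T.+1) (s : stage_state S n) (a : stage_act A n),
      is_min (expected_values supp Q s a (W supp Q y (n := succ_ord n)))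
             (worst_value supp Q s a (W supp Q y (n := succ_ord n)))) /\
   (forall (n : 'I_T.+1) (s : stage_state S n),
      is_max [set worst_value supp Q s a (W supp Q y (n := succ_ord n))
             | a in [set: stage_act A n]]
             (W supp Q y (n := widen1 n) s))) /\
  (* W_t(s) is the maximum of the lower values, for 0 <= t <= T *)
  (forall (t : 'I_T.+1) (s : S t),
      is_max [set V_lower Q y d (n := succ_ord t) s | d in [set: regime T S A]]
             (W supp Q y (n := succ_ord t) s)) /\
  (* selectors are maximin optimal *)
  (forall dstar : regime T S A, maximin_selector supp Q y dstar ->
      maximin_optimal Q y dstar /\
      W supp Q y (n := ord0) tt = theta_lower Q y dstar) /\
  is_max [set theta_lower Q y d | d in [set: regime T S A]]
         (W supp Q y (n := ord0) tt) /\
  (* default root set *)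
  (Q ord0 tt tt = [set initial_law M] ->
     W supp Q y (n := ord0) tt =
     \sum_(s0 : S 0%N) initial_law M s0 *
        W supp Q y (n := succ_ord (@ord0 T)) s0).
Proof.
have [om] := scm_Omega_inhabited R T S A M.
have inhS n : (n <= T)%N -> S n by move=> nT; exact: (@scm_S _ _ _ _ M n nT om).
have inhA : A := scm_A (M := M) (Ordinal hT) om.
have Qs (n : 'I_T.+1) s a : Q n s a `<=` simplex (R := R) (stage_supp supp s a).
  by have [] := hQ n s a.
have Q0 (n : 'I_T.+1) s a : Q n s a !=set0 by have [] := hQ n s a.
have Qc (n : 'I_T.+1) s a : @compact {ptws S n -> R} (Q n s a).
  by have [] := hQ n s a.
have Wmin := worst_value_is_min supp Q Q0 Qc.
(* One selector attains the maxima over regimes at all times and states, and that of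
   [theta_lower]. *)
have [d dW] := selector_exists y supp Q inhA.
split; [split => [n s a|n s]; [exact: Wmin|exact: W_is_max]|].
split=> [t s|].
  split; first by exists d => //; exact: selector_V_lower.
  by move=> _ [d' _ <-]; exact: V_lower_le_W.
split=> [d' d'W|].
  have th := selector_theta_lower y supp Q Qs Q0 Qc inhS inhA d' d'W.
  by split => [d''|//]; rewrite th; exact: theta_lower_le_W.
split=> [|Qroot].
  split; first by exists d => //; exact: selector_theta_lower.
  by move=> _ [d' _ <-]; exact: theta_lower_le_W.
have Qi : Q ord0 tt tt (initial_law M) by rewrite Qroot.
have -> : W supp Q y (n := ord0) tt = W supp Q y (n := widen1 ord0) tt.
  exact: (stage_fun_irr (fun n => W supp Q y (n := n)) 0%N).
(* The root has a single action and, here, a single kernel, so the maximum and the minimum both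
   range over one point. *)
have [[[] _ <-] _] := W_is_max y supp Q inhA ord0 tt.
have [[q + <-] _] := Wmin ord0 tt tt (W supp Q y (n := succ_ord ord0)).
rewrite Qroot => ->.
exact: (sum_stage_supp supp Q Qs ord0 tt tt _ _ Qi).
Qed.
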